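(* Let $G$ be a CERS. Then $G$ is regular if and only if the resonance graph $R(G)$ is a daisy cube.
   Context: An even ring system is a simple bipartite 2-connected plane graph with all interior vertices of degree 3 and all boundary vertices of degree 2 or 3. The inner dual is the graph on the inner faces, two faces adjacent iff they share an edge. A CERS (catacondensed even ring system) is an even ring system whose inner dual is a tree. The resonance graph $R(G)$ has as vertices the perfect matchings of $G$, with $M_1\sim M_2$ iff $M_1\oplus M_2$ is exactly the edge set of one inner face. If $F,F',F''$ are inner faces such that $F,F'$ share an edge $e$ and $F',F''$ share an edge $f$ (with $F\neq F''$), $(F,F',F'')$ is an adjacent triple of faces; it is regular if $d_G(e,f)$ is even and irregular otherwise, where the distance between two edges is the distance between the corresponding vertices of the line graph of $G$. A CERS is regular if it has at most two inner faces or every adjacent triple of faces is regular. For $B=\{0,1\}$ order $B^n$ by $u\le v$ iff $u_i\le v_i$ for all $i$. For $X\subseteq B^n$, $Q_n(X)$ is the subgraph of the hypercube $Q_n$ induced by $\{u\in B^n: u\le x \text{ for some } x\in X\}$; a graph is a daisy cube if it is isomorphic to $Q_n(X)$ for some $n$ and $X\subseteq B^n$. *)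

(* Defs.v *)
(* A plane graph is encoded as a combinatorial map
   (rotation system) on a finite set of darts D:
     a     : fixed-point-free involution (the two darts of an edge),
     s     : vertex rotation (its orbits are the vertices),
     phi   = a * s, i.e. phi x = s (a x) (its orbits are the faces),
   connected and of genus 0 (Euler's formula V - E + F = 2),
   together with a dart o designating the outer face. *)
From HB Require Import structures.
From mathcomp Require Import all_boot all_order all_fingroup.
Set Implicit Arguments. Unset Strict Implicit. Unset Printing Implicit Defensive.

Lemma phiE (D : finType) (a s : {perm D}) x : (a * s)%g x = s (a x).
Proof. by rewrite permM. Qed.

Section Map.
Variables (D : finType) (a s : {perm D}) (o : D).

Definition phi : {perm D} := (a * s)%g.
Definition vertices : {set {set D}} := porbits s.
Definition edges : {set {set D}} := porbits a.
Definition faces : {set {set D}} := porbits phi.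
Definition outer_face : {set D} := porbit phi o.
Definition inner_faces : {set {set D}} := faces :\ outer_face.

Definition map_axioms := (forall x, a (a x) = x) /\ (forall x, a x != x).
Definition map_connected :=
  forall x y : D, connect (fun u v => (v == a u) || (v == s u)) x y.
(* genus 0: the connected map is an embedding in the sphere (plane) *)
Definition planar_map := #|vertices| + #|faces| = #|edges| + 2.
Definition simple_map :=
  (forall x, a x \notin porbit s x) /\
  (forall x y, porbit s x = porbit s y -> porbit s (a x) = porbit s (a y) -> x = y).

Definition vadj : rel {set D} := fun u v => [exists x in u, a x \in v].

Definition bipartite_map :=
  exists c : D -> bool, forall x, c (s x) = c x /\ c (a x) = ~~ c x.

Definition induced_connected (S : {set {set D}}) :=
  {in S &, forall u v, connect [rel x y | [&& x \in S, y \in S & vadj x y]] u v}.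
Definition two_connected :=
  [/\ 3 <= #|vertices|, induced_connected vertices &
      forall w, w \in vertices -> induced_connected (vertices :\ w)].

Definition boundary_vertices : {set {set D}} := [set porbit s x | x in outer_face].
(* the degree of a vertex v is #|v| (the graph is simple) *)
Definition degree_cond :=
  forall v, v \in vertices ->
    if v \in boundary_vertices then (#|v| == 2) || (#|v| == 3) else #|v| == 3.

Definition even_ring_system :=
  [/\ map_axioms, map_connected, planar_map, simple_map &
      [/\ bipartite_map, two_connected & degree_cond]].

Definition dual_adj : rel {set D} :=
  fun F1 F2 => (F1 != F2) && [exists x in F1, a x \in F2].

Definition is_tree (V : {set {set D}}) (e : rel {set D}) :=
  [/\ V != set0,
      {in V &, forall u v, connect [rel x y | [&& x \in V, y \in V & e x y]] u v} &
      forall p : seq {set D}, uniq p -> all (mem V) p -> 3 <= size p -> ~~ path.cycle e p].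

Definition CERS := even_ring_system /\ is_tree inner_faces dual_adj.

Definition on_face (e F : {set D}) := [exists x in e, x \in F].

Definition ladj : rel {set D} :=
  fun e1 e2 => (e1 != e2) && [exists x in e1, exists y in e2, porbit s x == porbit s y].

Fixpoint lwalk (k : nat) (e1 e2 : {set D}) : bool :=
  if k is k'.+1 then [exists e3 in edges, ladj e1 e3 && lwalk k' e3 e2]
  else e1 == e2.

Definition ldist_even (e1 e2 : {set D}) :=
  exists k, [/\ ~~ odd k, lwalk k e1 e2 & forall j, j < k -> ~~ lwalk j e1 e2].

Definition regular_CERS :=
  #|inner_faces| <= 2 \/
  forall F F' F'' e f,
    F \in inner_faces -> F' \in inner_faces -> F'' \in inner_faces ->
    F != F' -> F' != F'' -> F != F'' ->
    e \in edges -> f \in edges ->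
    on_face e F -> on_face e F' -> on_face f F' -> on_face f F'' ->
    ldist_even e f.

(* a perfect matching, as the set of darts of its edges *)
Definition perfect_matching (M : {set D}) :=
  [forall x, (x \in M) == (a x \in M)] && [forall x, #|porbit s x :&: M| == 1].

Definition perfect_matchings : {set {set D}} := [set M | perfect_matching M].

Definition res_adj : rel {set D} :=
  fun M1 M2 => [exists F in inner_faces,
    (M1 :\: M2) :|: (M2 :\: M1) == F :|: [set a x | x in F]].

End Map.

Definition leB n (u v : {ffun 'I_n -> bool}) := [forall i, u i ==> v i].
Definition daisy_vertices n (X : {set {ffun 'I_n -> bool}}) :
  {set {ffun 'I_n -> bool}} := [set u | [exists x in X, leB u x]].
Definition hadj n (u v : {ffun 'I_n -> bool}) := #|[set i | u i != v i]| == 1.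

Definition is_daisy_cube (V : finType) (P : {set V}) (E : rel V) :=
  exists n (X : {set {ffun 'I_n -> bool}}) (f : V -> {ffun 'I_n -> bool}),
    [/\ {in P &, injective f}, f @: P = daisy_vertices X &
        {in P &, forall u v, E u v = hadj (f u) (f v)}].

(* Main.v *)
(* Over Z/2, Euler's formula says that every edge set meeting each vertex evenly is the boundary of
   a set of faces, unique once the outer face is excluded (and dually for cuts); this replaces all
   uses of the Jordan curve theorem. Since the inner dual is a tree, every vertex lies on the outer
   face, and the edges between inner faces ("chords") are pairwise disjoint. Fix a proper
   2-colouring of the vertices; the darts of a face alternate in colour, and "aligned" means that on
   each inner face all chords have the same colour. The shortest line-graph path between two chords
   of a face cannot join two tails or two heads, by planarity, so its parity compares their colours:
   regular is the same as aligned.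
   If G is aligned, there is a perfect matching M0 containing all chords. Every perfect matching is
   the sum of M0 and the boundary of a set S of inner faces, and S gives a matching iff it is
   independent in the inner dual. Subsets of independent sets are independent: R(G) is a daisy cube.
   Conversely, in a daisy cube each hypercube direction occurs at the zero vertex: sliding an edge
   down through squares preserves the face it flips. Every inner face can be flipped somewhere, so
   the matching at zero alternates along every inner face; so it contains every chord, and
   hence all chords of a face have the same colour. *)
Require Import Defs.
From mathcomp Require Import all_boot all_order all_fingroup all_algebra.
Set Implicit Arguments. Unset Strict Implicit. Unset Printing Implicit Defensive.

(** * Orbits of a permutation *)

Section Orbits.
Variables (D : finType) (t : {perm D}).

Lemma mem_porbits d : porbit t d \in porbits t.
Proof. exact: imset_f. Qed.

Lemma porbit_step d : porbit t (t d) = porbit t d.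
Proof. exact: (porbit_perm t 1). Qed.

Lemma porbit_eq_of_mem x d : x \in porbit t d -> porbit t x = porbit t d.
Proof. by rewrite -eq_porbit_mem => /eqP. Qed.

Lemma porbit_inv_fun (T : Type) (f : D -> T) :
  (forall d, f (t d) = f d) -> forall x y, x \in porbit t y -> f x = f y.
Proof.
move=> ft x y /porbitP[i ->]; elim: i => [|i IH]; first by rewrite expg0 perm1.
by rewrite expgSr permM ft.
Qed.
End Orbits.

(** * Mod 2 homology of a map *)

Section Incidence.
Variables (D : finType) (a : {perm D}).
Hypothesis (aK : forall x, a (a x) = x) (a_neq : forall x, a x != x).
Import GRing.Theory.
Local Open Scope ring_scope.

Lemma porbit_invol d : porbit a d = [set d; a d].
Proof.
apply/setP=> x; rewrite !inE; apply/idP/idP => [/porbitP[i ->]|].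
  elim: i => [|i IH]; first by rewrite expg0 perm1 eqxx.
  by rewrite expgSr permM; case/orP: IH => /eqP->; rewrite ?aK eqxx ?orbT.
by case/orP => /eqP->; rewrite ?porbit_id // -(porbit_step a d) porbit_id.
Qed.

Definition orb_idx (t : {perm D}) d : 'I_#|porbits t| :=
  enum_rank_in (mem_porbits t d) (porbit t d).

Lemma enum_val_orb_idx t d : enum_val (orb_idx t d) = porbit t d.
Proof. by rewrite enum_rankK_in ?mem_porbits. Qed.

Lemma orb_idxP t (i : 'I_#|porbits t|) : exists d, i = orb_idx t d.
Proof.
have /imsetP[d _ Ed] := enum_valP i; exists d.
by apply: enum_val_inj; rewrite enum_val_orb_idx.
Qed.

Lemma mem_enum_val_orb t d (i : 'I_#|porbits t|) :
  (d \in (enum_val i : {set D})) = (i == orb_idx t d).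
Proof.
have [x ->] := orb_idxP i; rewrite enum_val_orb_idx -eq_porbit_mem.
by rewrite -(inj_eq enum_val_inj) !enum_val_orb_idx eq_sym.
Qed.

(** A vector indexed by orbits is read as a function on darts, constant along each orbit. The
    scalars are [bool], the field with two elements. *)
Definition orb_eval t (w : 'rV[bool]_#|porbits t|) d := w 0 (orb_idx t d).

(** The cellular boundary from faces to edges when the orbits of [t] are the faces, and the
    coboundary from vertices to edges when they are the vertices. Darts are counted mod 2, so an
    edge with both darts in one orbit contributes zero. *)
Definition incidence (t : {perm D}) : 'M[bool]_(#|porbits t|, #|porbits a|) :=
  \matrix_(i, j) \sum_d ((d \in (enum_val i : {set D})) * (d \in (enum_val j : {set D}))).

Lemma sum_orb_eval t (w : 'rV[bool]_#|porbits t|) d :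
  \sum_i w 0 i * (d \in (enum_val i : {set D})) = orb_eval w d.
Proof.
rewrite (bigD1 (orb_idx t d)) //= mem_enum_val_orb eqxx mulr1 big1 ?addr0 // => i /negPf ni.
by rewrite mem_enum_val_orb ni mulr0.
Qed.

Lemma mul_incidence t (w : 'rV_#|porbits t|) d :
  orb_eval (w *m incidence t) d = orb_eval w d + orb_eval w (a d).
Proof.
rewrite /orb_eval mxE.
transitivity (\sum_x (x \in porbit a d) * (\sum_i w 0 i * (x \in (enum_val i : {set D})))).
  under eq_bigr do rewrite mxE mulr_sumr.
  rewrite exchange_big /=; apply: eq_bigr => x _; rewrite mulr_sumr.
  by apply: eq_bigr => i _; rewrite enum_val_orb_idx mulrA mulrC.
rewrite porbit_invol (bigD1 d) // (bigD1 (a d)) ?a_neq //= !inE !eqxx orbT !mul1r.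
rewrite !sum_orb_eval big1 ?addr0 // => x /andP[/negPf nd /negPf na].
by rewrite !inE nd na mul0r.
Qed.

Lemma mul_incidence_tr t (z : 'rV_#|porbits a|) d :
  orb_eval (z *m (incidence t)^T) d = \sum_(x in porbit t d) orb_eval z x.
Proof.
rewrite {1}/orb_eval mxE.
under eq_bigr do rewrite !mxE mulr_sumr.
rewrite exchange_big /= [RHS]big_mkcond; apply: eq_bigr => x _.
rewrite -(sum_orb_eval z x); under eq_bigr do rewrite enum_val_orb_idx.
case: ifP => Hx; last by rewrite big1 // => i _; rewrite mul0r mulr0.
by apply: eq_bigr => i _; rewrite mul1r.
Qed.

Lemma orb_eval_inj t (w1 w2 : 'rV_#|porbits t|) :
  orb_eval w1 =1 orb_eval w2 -> w1 = w2.
Proof. by move=> E; apply/rowP=> i; have [d ->] := orb_idxP i; apply: E. Qed.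

Lemma orb_eval_step t (w : 'rV_#|porbits t|) d : orb_eval w (t d) = orb_eval w d.
Proof.
by congr (w 0 _); apply: enum_val_inj; rewrite !enum_val_orb_idx porbit_step.
Qed.

Lemma orb_eval_surj (t : {perm D}) (f : D -> bool) : (forall d, f (t d) = f d) ->
  exists w : 'rV_#|porbits t|, orb_eval w =1 f.
Proof.
(* The [false] branch is never reached, since orbits are nonempty. *)
move=> ft; exists (\row_i if [pick x in (enum_val i : {set D})] is Some x then f x else false).
move=> d; rewrite /orb_eval mxE enum_val_orb_idx.
case: pickP => [x|/(_ d)]; last by rewrite porbit_id.
exact: porbit_inv_fun.
Qed.

Hypothesis (d0 : D).

(** A vector in the left kernel takes equal values at the two darts of each edge, hence is constant
    by connectivity; so the kernel has dimension at most one. *)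
Lemma rank_incidence (t : {perm D}) :
  (forall x y, connect (fun u v => (v == a u) || (v == t u)) x y) ->
  (#|porbits t| <= (\rank (incidence t)).+1)%N.
Proof.
move=> conn.
suff: (\rank (kermx (incidence t)) <= 1)%N.
  by rewrite mxrank_ker leq_subLR addn1.
apply: leq_trans (rank_leq_row (const_mx 1 : 'rV[bool]_#|porbits t|)).
apply: mxrankS; apply/row_subP => i.
set w := row i _.
have w0 : w *m incidence t = 0.
  by apply/sub_kermxP; apply: row_sub.
have wc d : orb_eval w d = orb_eval w d0.
  have /connectP[p pth ->] := conn d0 d; elim/last_ind: p pth => //= p y IH.
  rewrite rcons_path last_rcons => /andP[/IH <- /orP[]/eqP->]; last exact: orb_eval_step.
  have := congr1 (fun m => orb_eval m (last d0 p)) w0.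
  rewrite /= mul_incidence {3}/orb_eval mxE => /eqP.
  by rewrite addr_eq0 => /eqP->; case: orb_eval.
suff -> : w = orb_eval w d0 *: const_mx 1 by apply: scalemx_sub.
by apply: orb_eval_inj => d; rewrite wc {2}/orb_eval !mxE mulr1.
Qed.

End Incidence.

(* The planar case is [t] = faces, [u] = vertices, and dually. The composite of the two incidence
   matrices vanishes, and Euler's formula leaves no room for homology between them. *)
Section Exact.
Variables (D : finType) (a t u : {perm D}) (d0 : D).
Hypothesis (aK : forall x, a (a x) = x) (a_neq : forall x, a x != x).
Hypothesis tE : forall x, t x = u (a x).
Hypothesis conn_t : forall x y, connect (fun u v => (v == a u) || (v == t u)) x y.
Hypothesis conn_u : forall x y, connect (fun u' v => (v == a u') || (v == u u')) x y.
Hypothesis euler : #|porbits t| + #|porbits u| = #|porbits a| + 2.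
Import GRing.Theory.
Local Open Scope ring_scope.

Lemma orbit_exact (Z : D -> bool) :
  (forall d, Z (a d) = Z d) ->
  (forall d, \big[addb/false]_(x in porbit u d) Z x = false) ->
  exists f : D -> bool, (forall d, f (t d) = f d) /\ forall d, Z d = f d (+) f (a d).
Proof.
move=> Za Zu; have [z zE] := orb_eval_surj Za.
have z0 : z *m (incidence a u)^T = 0.
  apply: orb_eval_inj => d; rewrite mul_incidence_tr {2}/orb_eval mxE; apply: etrans (Zu d).
  by apply: eq_bigr => x _; rewrite zE.
(* Boundary of a boundary: around an orbit of [u], the terms at [x] shifted by [u] are the terms at
   [a x], so the sum cancels. *)
have tu0 : incidence a t *m (incidence a u)^T = 0.
  apply/row_matrixP => i; rewrite row_mul row0 rowE; apply: orb_eval_inj => d.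
  rewrite mul_incidence_tr {2}/orb_eval mxE.
  under eq_bigr do rewrite mul_incidence //.
  rewrite big_split /= (reindex_inj (@perm_inj _ u)) /=.
  rewrite (eq_bigl (mem (porbit u d))); last first.
    by move=> x; rewrite /= -!eq_porbit_mem porbit_step.
  rewrite -big_split big1 //= => x _.
  have -> : u x = t (a x) by rewrite tE aK.
  by rewrite orb_eval_step; case: orb_eval.
have le1 : (incidence a t <= kermx (incidence a u)^T)%MS by apply/sub_kermxP.
have le2 : (z <= kermx (incidence a u)^T)%MS by apply/sub_kermxP.
have eqr : (incidence a t == kermx (incidence a u)^T)%MS.
  rewrite -(mxrank_leqif_eq le1) eqn_leq mxrankS //= mxrank_ker mxrank_tr.
  have := rank_incidence aK a_neq d0 conn_t; have := rank_incidence aK a_neq d0 conn_u.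
  (* Added together, the two rank bounds and Euler's formula show that the ranks sum to at least the
     number of edges. *)
  move: euler; move: #|_| #|_| #|_| (\rank _) (\rank _) => T U E ru rt Eq Hu Ht.
  rewrite leq_subLR -(leq_add2r 2) -Eq; apply: leq_trans (leq_add Ht Hu) _.
  by rewrite addSn addnS addn2 (addnC ru).
have /submxP[w zw] : (z <= incidence a t)%MS by rewrite (eqmxP eqr).
exists (orb_eval w); split=> [d|d]; first exact: orb_eval_step.
by rewrite -zE zw mul_incidence.
Qed.
End Exact.

Lemma connect_in_path (T : finType) (S : {set T}) (e : rel T) u v :
  connect [rel x y | [&& x \in S, y \in S & e x y]] u v ->
  exists p, [/\ path e u p, last u p = v & {subset p <= S}].
Proof.
case/connectP=> p; elim: p u => [|w p IH] u /=; first by move=> _ ->; exists [::].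
case/andP=> /and3P[_ wS euw] /IH{}IH /IH[q [pth lst sub]].
exists (w :: q); split=> //=; first by rewrite euw.
by move=> x; rewrite inE => /predU1P[->|/sub].
Qed.

(** * Exactness in a plane map and absence of bridges *)

Section PlaneMap.
Variables (D : finType) (a s : {perm D}) (o : D).
Hypothesis G : even_ring_system a s o.

Local Notation ph := (phi a s).
Local Notation face x := (porbit (phi a s) x).
Local Notation vert x := (porbit s x).
Local Notation outer x := (x \in outer_face a s o).

Lemma aK x : a (a x) = x. Proof. by case: G => -[]. Qed.
Lemma a_neq x : a x != x. Proof. by case: G => -[]. Qed.
Lemma ph_a x : ph (a x) = s x. Proof. by rewrite /phi phiE aK. Qed.
Lemma face_ph x : face (ph x) = face x. Proof. exact: porbit_step. Qed.
Lemma face_a x : face (a x) = face (s x). Proof. by rewrite -ph_a face_ph. Qed.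
Lemma vert_s x : vert (s x) = vert x. Proof. exact: porbit_step. Qed.
Lemma vert_ph x : vert (ph x) = vert (a x). Proof. by rewrite /phi phiE vert_s. Qed.

Lemma mem_face x y : (x \in face y) = (face x == face y).
Proof. by rewrite eq_porbit_mem. Qed.
Lemma mem_vert x y : (x \in vert y) = (vert x == vert y).
Proof. by rewrite eq_porbit_mem. Qed.
Lemma outer_eq x y : face x = face y -> outer x = outer y.
Proof. by rewrite !mem_face => ->. Qed.
Lemma outer_ph x : outer (ph x) = outer x. Proof. exact/outer_eq/face_ph. Qed.
Lemma outer_a x : outer (a x) = outer (s x). Proof. exact/outer_eq/face_a. Qed.

Lemma vert_a_neq x : vert (a x) != vert x.
Proof. by rewrite -mem_vert; case: G => _ _ _ [/(_ x)]. Qed.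

Lemma conn_s x y : connect (fun u v => (v == a u) || (v == s u)) x y.
Proof. by case: G => _ /(_ x y). Qed.

Lemma conn_ph x y : connect (fun u v => (v == a u) || (v == ph u)) x y.
Proof.
apply: connect_sub (conn_s x y) => u v /orP[]/eqP->; first by apply: connect1; rewrite eqxx.
apply: (@connect_trans _ _ (a u)); apply: connect1; rewrite ?eqxx //.
by rewrite ph_a eqxx orbT.
Qed.

(** The uniqueness half of exactness: a set of faces with empty boundary contains all faces or
    none. *)
Lemma face_const (T : Type) (f : D -> T) :
  (forall x, f (ph x) = f x) -> (forall x, f (a x) = f x) -> forall x y, f x = f y.
Proof.
move=> fp fa x y; have /connectP[p pth ->] := conn_ph x y.
by elim: p x pth => //= z p IH x /andP[/orP[]/eqP-> /IH <-]; rewrite ?fa ?fp.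
Qed.

Lemma face_exact (Z : D -> bool) :
  (forall d, Z (a d) = Z d) ->
  (forall d, \big[addb/false]_(x in vert d) Z x = false) ->
  exists f : D -> bool, (forall d, f (ph d) = f d) /\ forall d, Z d = f d (+) f (a d).
Proof.
apply: (orbit_exact o aK a_neq (phiE a s) conn_ph conn_s).
by case: G => _ _; rewrite /planar_map addnC.
Qed.

(** An edge set meeting every face evenly is a cut, and [f] names its two sides. *)
Lemma vert_exact (Z : D -> bool) :
  (forall d, Z (a d) = Z d) ->
  (forall d, \big[addb/false]_(x in face d) Z x = false) ->
  exists f : D -> bool, (forall d, f (s d) = f d) /\ forall d, Z d = f d (+) f (a d).
Proof.
apply: (orbit_exact o aK a_neq _ conn_s conn_ph) => [x|]; first by rewrite ph_a.
by case: G.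
Qed.

Lemma sum_edge (P : {set D}) x :
  \big[addb/false]_(d in P) ((d == x) (+) (d == a x)) = (x \in P) (+) (a x \in P).
Proof.
have sum1 y : \big[addb/false]_(d in P) (d == y) = (y \in P).
  rewrite big_mkcond (bigD1 y) //= eqxx big1 ?addbF => [|d /negPf->]; last by case: ifP.
  by case: (y \in P).
by rewrite big_split /= !sum1.
Qed.

Lemma edge_sym x d : (a d == x) (+) (a d == a x) = (d == x) (+) (d == a x).
Proof. by rewrite (can_eq aK) -{1}(aK x) (can_eq aK) addbC. Qed.

(* Over Z/2, a walk is a chain of edges whose boundary is the sum of its ends. *)
Lemma path_chain u p : u \in vertices s -> path (vadj a) u p ->
    {subset p <= vertices s} ->
  exists Z : D -> bool, [/\ forall d, Z (a d) = Z d,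
    forall d, \big[addb/false]_(x in vert d) Z x = (vert d == u) (+) (vert d == last u p) &
    forall d, Z d -> vert d \in u :: p].
Proof.
elim: p u => [|v p IH] u uV /=.
  move=> _ _; exists (fun => false); split=> // d; by rewrite addbb big1.
case/andP=> /exists_inP[x xu axv] pth sub.
have vV : v \in vertices s by apply: sub; rewrite mem_head.
case: (IH v vV pth) => [w wp|Z [Za Zs Zp]]; first by apply: sub; rewrite inE wp orbT.
have Eu : u = vert x by case/imsetP: uV xu => z _ -> /porbit_eq_of_mem.
have Ev : v = vert (a x) by case/imsetP: vV axv => z _ -> /porbit_eq_of_mem.
exists (fun d => ((d == x) (+) (d == a x)) (+) Z d); split=> [d|d|d].
- by rewrite Za edge_sym.
- rewrite big_split /= sum_edge Zs !mem_vert !(eq_sym _ (vert d)) -Eu -Ev.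
  by rewrite addbA -(addbA _ _ (_ == v)) addbb addbF.
- have [->|_] := eqVneq d x; first by rewrite -Eu mem_head.
  have [->|_ /=] := eqVneq d (a x); first by rewrite -Ev !inE eqxx orbT.
  by move/Zp => H; rewrite in_cons H orbT.
Qed.

Lemma bipartition : exists c : D -> bool, (forall x, c (s x) = c x) /\ (forall x, c (a x) = ~~ c x).
Proof. by case: G => _ _ _ _ [[c Hc] _ _]; exists c; split=> x; case: (Hc x). Qed.

Lemma vertices_path u v : u \in vertices s -> v \in vertices s ->
  exists p, [/\ path (vadj a) u p, last u p = v & {subset p <= vertices s}].
Proof.
by case: G => _ _ _ _ [_ [_ conn _] _] uV vV; apply: connect_in_path (conn _ _ uV vV).
Qed.

(** By 2-connectedness the ends of [x] are joined through a third vertex [w] without using the edge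
    of [x]. Adding that edge gives an even chain; it bounds a set of faces, which contains exactly
    one side of [x]. *)
Lemma no_bridge x : face (a x) != face x.
Proof.
have vV y : vert y \in vertices s := mem_porbits s y.
have /card_gt0P[w] : 0 < #|vertices s :\ vert x :\ vert (a x)|.
  case: G => _ _ _ _ [_ [V3 _ _] _]; move: V3.
  rewrite (cardsD1 (vert x)) (cardsD1 (vert (a x)) (vertices s :\ vert x)).
  by case: (vert x \in _); case: (vert (a x) \in _); case: #|_| => [|[|]].
rewrite !inE => /and3P[wax wx wV].
have conn y : {in vertices s :\ y &, forall u v, exists p, [/\ path (vadj a) u p,
    last u p = v & {subset p <= vertices s :\ y}]}.
  move=> u v uV vvV; case: G => _ _ _ _ [_ [_ _ C] _].
  have [yV|nV] := boolP (y \in vertices s).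
    exact: connect_in_path (C y yV u v uV vvV).
  have Ey : vertices s :\ y = vertices s.
    by apply/setP=> z; rewrite !inE; case: eqVneq => // ->; rewrite (negPf nV).
  by rewrite Ey; apply: vertices_path; rewrite -Ey.
have [||p [p1 p2 p3]] := conn (vert (a x)) (vert x) w.
- by rewrite !inE vV eq_sym vert_a_neq.
- by rewrite !inE wax wV.
have [||q [q1 q2 q3]] := conn (vert x) w (vert (a x)).
- by rewrite !inE wx wV.
- by rewrite !inE vV vert_a_neq.
have [|Z [Za Zs Zp]] := path_chain (vV x) p1.
  by move=> z /p3; rewrite inE => /andP[].
have [|Y [Ya Ys Yq]] := path_chain wV q1.
  by move=> z /q3; rewrite inE => /andP[].
(* The first walk misses the vertex of [a x], so its chain misses the edge; the second one misses
   the vertex of [x]. *)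
have Zx : Z x = false.
  rewrite -Za; apply/negP => /Zp; rewrite inE (negPf (vert_a_neq x)) /= => /p3.
  by rewrite !inE eqxx.
have Yx : Y x = false.
  apply/negP => /Yq; rewrite inE eq_sym (negPf wx) /= => /q3.
  by rewrite !inE eqxx.
pose X d := (((d == x) (+) (d == a x)) (+) Z d) (+) Y d.
have [d|d|f [fp fE]] := @face_exact X; first by rewrite /X edge_sym Za Ya.
  rewrite /X 2!big_split /= sum_edge Zs Ys p2 q2 !mem_vert !(eq_sym _ (vert d)).
  by case: (_ == _) (_ == _) (_ == _) => [][][].
apply/eqP => /eqP; rewrite -mem_face => /(porbit_inv_fun fp) E.
by have := fE x; rewrite E addbb /X Zx Yx eqxx eq_sym (negPf (a_neq x)).
Qed.

Lemma s_neq x : s x != x.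
Proof. by apply: contraNneq (no_bridge x) => E; rewrite face_a E. Qed.

Lemma face_s_neq x : face (s x) != face x.
Proof. by rewrite -face_a no_bridge. Qed.

End PlaneMap.

(** * Local structure of a CERS *)

Section Cers.
Variables (D : finType) (a s : {perm D}) (o : D).
Hypothesis C : CERS a s o.

Local Notation ph := (phi a s).
Local Notation face x := (porbit (phi a s) x).
Local Notation vert x := (porbit s x).
Local Notation outer x := (x \in outer_face a s o).
Local Notation G := (proj1 C).

Lemma inner_face x : (face x \in inner_faces a s o) = ~~ outer x.
Proof. by rewrite !inE mem_porbits andbT mem_face. Qed.

Lemma dual_adj_a x : dual_adj a (face x) (face (a x)).
Proof.
rewrite /dual_adj eq_sym (no_bridge G); apply/exists_inP.
by exists x; rewrite porbit_id.
Qed.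

(* An inner vertex would close a triangle in the inner dual. *)
Lemma outer_at d : exists2 x, x \in vert d & outer x.
Proof.
have [_ _ _ _ [_ _ /(_ _ (mem_porbits s d))]] := G.
case: ifPn => [/imsetP[x xO ->] _|nb /eqP deg]; first by exists x; rewrite ?porbit_id.
have no x : x \in vert d -> ~~ outer x.
  by rewrite -eq_porbit_mem => /eqP E; apply: contra nb => xO; rewrite -E imset_f.
have n0 := no d (porbit_id s d).
have n1 := no (s d) ltac:(by rewrite mem_vert vert_s).
have n2 := no (s (s d)) ltac:(by rewrite mem_vert !vert_s).
have s3 : s (s (s d)) = d by have := iter_porbit s d; rewrite deg.
have f0 := face_s_neq G d; have f1 := face_s_neq G (s d).
have f2 := face_s_neq G (s (s d)); rewrite s3 in f2.
have [_ _ acyclic] := proj2 C.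
exfalso; apply: (negP (acyclic [:: face d; face (s d); face (s (s d))] _ _ isT)).
- by rewrite /= !inE negb_or (eq_sym (face d)) f0 f2 eq_sym f1.
- by rewrite /= !inner_face n0 n1 n2.
- have := dual_adj_a (s (s d)); rewrite (face_a G) s3 => adj2.
  have := dual_adj_a (s d); rewrite (face_a G) => adj1.
  by have := dual_adj_a d; rewrite (face_a G) => adj0; rewrite /= adj0 adj1 adj2.
Qed.

Lemma vertE d : (s (s d) = d /\ vert d = [set d; s d]) \/
  (s (s (s d)) = d /\ vert d = d |: [set s d; s (s d)]).
Proof.
have [_ _ _ _ [_ _ /(_ _ (mem_porbits s d)) deg]] := G.
have : (#|vert d| == 2) || (#|vert d| == 3).
  by move: deg; case: ifP => // _ ->; rewrite orbT.
case/orP=> /eqP Ed; [left|right]; (split; first by have := iter_porbit s d; rewrite Ed);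
  by apply/setP=> x; rewrite porbit_traject Ed /= !inE.
Qed.

Lemma outer_s d : outer d -> ~~ outer (s d).
Proof.
by move=> od; apply: contraNN (face_s_neq G d) => osd; rewrite -mem_face (porbit_eq_of_mem od).
Qed.

Definition is_chord x := ~~ outer x && ~~ outer (a x).
Local Notation chord := is_chord.

Lemma chord_a x : chord (a x) = chord x.
Proof. by rewrite /is_chord (aK G) andbC. Qed.

(** The darts [a x] and [s x] lie on one face, so [x] and [s x] are both inner; the outer dart at
    their vertex must be a third one. *)
Lemma chord_vert x : chord x -> outer (s (s x)) /\ s (s (s x)) = x.
Proof.
rewrite /is_chord (outer_a G) => /andP[nx nsx]; have [d dx od] := outer_at x.
case: (vertE x) => -[E1 E2]; move: dx; rewrite E2 !inE => H.
  by case/orP: H => /eqP Ed1; rewrite Ed1 ?(negPf nx) ?(negPf nsx) in od.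
by split=> //; case/or3P: H => /eqP Ed1; rewrite Ed1 ?(negPf nx) ?(negPf nsx) // in od.
Qed.

(** Of the three darts at the vertex of [y], [s (s y)] is outer and the edge of [s y] has the outer
    face on its other side. *)
Lemma chord_vert_inj x y : chord x -> chord y -> vert x = vert y -> x = y.
Proof.
move=> cx cy /eqP; rewrite -mem_vert; have [oy s3] := chord_vert cy.
case: (vertE y) => -[E1 ->]; rewrite !inE.
  by rewrite E1 in oy; case/andP: cy; rewrite oy.
case/or3P=> /eqP // E; move: cx; rewrite /is_chord E ?oy // (outer_a G).
by rewrite oy andbF.
Qed.

(* Two chords between the same pair of faces would form an edge cut; the outer face visits
   every vertex without crossing it. *)
Lemma chord_faces_inj x y : chord x -> chord y ->
  face x = face y -> face (a x) = face (a y) -> x = y.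
Proof.
move=> cx cy Exy Eaxy.
pose Z d := ((d == x) (+) (d == a x)) (+) ((d == y) (+) (d == a y)).
have [d|d|f [fs fE]] := vert_exact G (Z := Z); first by rewrite /Z !(edge_sym G).
  rewrite /Z big_split /= !sum_edge !mem_face Exy Eaxy.
  by rewrite addbb.
have Zo d : outer d -> Z d = false.
  move=> od; have ne z : ~~ outer z -> (d == z) = false by apply: contraNF => /eqP <-.
  by move: cx cy; rewrite /is_chord /Z => /andP[/ne-> /ne->] /andP[/ne-> /ne->].
have fo d : outer d -> f d = f o.
  case/porbitP => i ->.
  elim: i => [|i IH]; first by rewrite expg0 perm1.
  rewrite expgSr permM /phi phiE fs -IH.
  by have := fE ((ph ^+ i)%g o); rewrite Zo ?mem_porbit //; case: (f _) (f _) => [][].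
have fc d : f d = f o.
  by have [z zd oz] := outer_at d; rewrite -(fo _ oz) (porbit_inv_fun fs zd).
have := fE x; rewrite !fc addbb /Z eqxx eq_sym (negPf (a_neq G x)) /=.
have -> : (x == a y) = false.
  by apply: contraNF (no_bridge G y) => /eqP <-; rewrite Exy.
by case: eqP.
Qed.

Lemma card_setI2 (T : finType) (M : {set T}) x y : x != y ->
  #|[set x; y] :&: M| = (x \in M) + (y \in M).
Proof.
move=> nxy; rewrite -sum1_card (eq_bigl (fun z => (z \in [set x; y]) && (z \in M))); last first.
  by move=> z; rewrite !inE.
rewrite big_mkcondr /= big_setU1 ?inE //= big_set1.
by do 2!case: (_ \in _).
Qed.

Lemma card_setI3 (T : finType) (M : {set T}) x y z : x != y -> x != z -> y != z ->
  #|(x |: [set y; z]) :&: M| = (x \in M) + (y \in M) + (z \in M).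
Proof.
move=> nxy nxz nyz; rewrite -addnA -(card_setI2 M nyz) setIUl cardsU setIACA setIid.
have -> : #|[set x] :&: M| = (x \in M).
  by case: (boolP (x \in M)) => xM; [rewrite (setIidPl _) ?cards1 // sub1set|
    rewrite disjoint_setI0 ?cards0 // disjoints1].
rewrite [_ :&: [set y; z]]disjoint_setI0 ?set0I ?cards0 ?subn0 //.
by rewrite disjoints1 !inE negb_or nxy nxz.
Qed.

(** Every vertex has an outer dart [d]. Reading the rotation from [d] fixes the order of the darts;
    in degree three [s d] is then the chord. *)
Lemma perfect_matchingP (M : {set D}) : reflect
  ((forall x, (a x \in M) = (x \in M)) /\ forall d, outer d ->
     (s (s d) = d -> (d \in M) + (s d \in M) = 1) /\
     (s (s (s d)) = d -> (d \in M) + (s d \in M) + (s (s d) \in M) = 1))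
  (perfect_matching a s M).
Proof.
have E d : s (s d) = d -> #|vert d :&: M| = (d \in M) + (s d \in M).
  move=> s2; rewrite -(card_setI2 M) ?(eq_sym d) ?(s_neq G) //.
  case: (vertE d) => -[s3 ->] //; by rewrite s2 in s3; have := s_neq G d; rewrite s3 eqxx.
have E' d : s (s (s d)) = d -> #|vert d :&: M| = (d \in M) + (s d \in M) + (s (s d) \in M).
  move=> s3; have n2 : s (s d) != d by rewrite -{2}s3 eq_sym (s_neq G).
  rewrite -(card_setI3 M) ?(eq_sym d (s (s d))) // 1?eq_sym ?(s_neq G) //.
  by case: (vertE d) => -[s2 ->] //; rewrite s2 eqxx in n2.
apply: (iffP andP) => [[/forallP Ha /forallP H]|[Ha H]].
  split; last by move=> d _; split=> [/E|/E'] <-; apply/eqP/H.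
  by move=> x; rewrite -(eqP (Ha x)).
split; apply/forallP => x; first by rewrite Ha.
have [d dx od] := outer_at x.
have [H2 H3] := H d od; rewrite -(porbit_eq_of_mem dx).
by case: (vertE d) => -[s2 _]; [rewrite E ?H2|rewrite E' ?H3].
Qed.

Lemma perfect_matching_a (M : {set D}) x : perfect_matching a s M -> (a x \in M) = (x \in M).
Proof. by case/perfect_matchingP. Qed.

Lemma perfect_matching_inj (M : {set D}) x y : perfect_matching a s M ->
  x \in M -> y \in M -> vert x = vert y -> x = y.
Proof.
case/andP=> _ /forallP/(_ x) /cards1P[z Ez] xM yM E.
have : y \in vert x :&: M by rewrite inE yM E porbit_id.
have : x \in vert x :&: M by rewrite inE xM porbit_id.
by rewrite Ez !inE => /eqP-> /eqP.
Qed.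

End Cers.

(** * Perfect matchings glued from the faces *)

Lemma path_connect_in (T : finType) (S : {set T}) (e : rel T) u p :
  path e u p -> {subset u :: p <= S} ->
  connect [rel x y | [&& x \in S, y \in S & e x y]] u (last u p).
Proof.
elim: p u => [|v p IH] u //= /andP[euv pth] sub.
apply: (connect_trans (connect1 _) (IH v pth _)).
  by rewrite /= euv !sub // !inE eqxx ?orbT.
by move=> x xp; apply: sub; rewrite inE xp orbT.
Qed.

(* Orient an edge towards the root: its head reaches the root without its tail. *)
Lemma acyclic_orientation (T : finType) (V : {set T}) (e : rel T) (r : T) :
    symmetric e -> irreflexive e -> r \in V ->
    {in V &, forall u v, connect [rel x y | [&& x \in V, y \in V & e x y]] u v} ->
    (forall p, uniq p -> all (mem V) p -> 3 <= size p -> ~~ path.cycle e p) ->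
  exists R : rel T, [/\ forall u v w, R u v -> R u w -> v = w,
    {in V &, forall u v, e u v -> R u v || R v u} &
    {in V, forall u, e u r -> R u r}].
Proof.
move=> e_sym e_irr rV conn acyc.
pose E u := [rel x y | [&& x \in V :\ u, y \in V :\ u & e x y]].
exists (fun u v => [&& u \in V, v \in V, e u v & connect (E u) v r]); split.
(* Two heads of [u] are joined by a path missing [u], which closes to a cycle through [u]. *)
- move=> u v w /and4P[uV vV euv cv] /and4P[_ wV euw cw]; apply/eqP/negPn/negP => nvw.
  have Esym : connect_sym (E u).
    by apply: sym_connect_sym => x y; rewrite /= e_sym andbCA.
  have nuv x : e u x -> x != u by apply: contraTneq => ->; rewrite e_irr.
  have cvw : connect (E u) v w by apply: connect_trans cv _; rewrite Esym.
  have [p [pth lst sub]] := connect_in_path cvw.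
  move: lst; case/shortenP: pth => q qth quniq qsub lst.
  have {qsub}qsub x : x \in q -> (x != u) && (x \in V).
    by move/qsub/sub; rewrite !inE.
  apply: (negP (acyc (u :: v :: q) _ _ _)).
  + rewrite cons_uniq quniq inE negb_or eq_sym nuv //= andbT.
    by apply/negP => /qsub; rewrite eqxx.
  + by rewrite /= uV vV; apply/allP => x /qsub /andP[].
  + by case: q lst {qth quniq qsub} nvw => //= ->; rewrite eqxx.
  + by rewrite /= euv rcons_path qth lst e_sym.
- move=> u v uV vV euv; have [p [pth lst sub]] := connect_in_path (conn u r uV rV).
  move: lst; case/shortenP: pth => q qth quniq qsub lst.
  have {}qsub x : x \in q -> x \in V by move/qsub/sub.
  have nuv : v != u by apply: contraTneq euv => ->; rewrite e_irr.
  rewrite uV vV (e_sym v) euv /= -lst; apply/orP.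
  (* If the simple path from [u] to the root meets [v], its remainder from [v] avoids [u]; otherwise
     it joins [u] to the root without [v]. *)
  case: (boolP (v \in q)) => [vq|nvq]; [left|right].
    case/splitPr: vq qth quniq qsub lst => q1 q2.
    rewrite cat_path last_cat /= => /and3P[_ _ q2th] /andP[nu _] qsub _.
    apply: path_connect_in => // x xq; rewrite !inE qsub ?mem_cat ?xq ?orbT // andbT.
    by apply: contraNneq nu => <-; rewrite mem_cat xq orbT.
  apply: path_connect_in => // x; rewrite !inE => /predU1P[->|xq].
    by rewrite eq_sym nuv.
  by rewrite qsub // andbT; apply: contraNneq nvq => <-.
- by move=> u uV eur; rewrite uV rV eur connect0.
Qed.

Section Matchings.
Variables (D : finType) (a s : {perm D}) (o : D).
Hypothesis C : CERS a s o.

Local Notation face x := (porbit (phi a s) x).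
Local Notation outer x := (x \in outer_face a s o).
Local Notation G := (proj1 C).

Lemma dual_adj_sym : symmetric (dual_adj a).
Proof.
move=> F1 F2; rewrite /dual_adj eq_sym; congr andb.
by apply/exists_inP/exists_inP=> -[x xF axF]; exists (a x); rewrite ?(aK G).
Qed.

Lemma outer_ss d : s (s (s d)) = d -> outer d -> ~~ outer (s (s d)).
Proof. by move=> s3; apply: contraL => /(outer_s C); rewrite s3. Qed.

(** Adjacency in the resonance graph as an equation over Z/2, whose right side is the boundary of
    [F]. *)
Definition flip (F M1 M2 : {set D}) :=
  forall d, (d \in M1) (+) (d \in M2) = (d \in F) (+) (a d \in F).

Lemma face_a_disjoint x d : d \in face x -> (a d \in face x) = false.
Proof. by rewrite !mem_face => /eqP <-; exact: negbTE (no_bridge G d). Qed.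

Lemma res_adjP M1 M2 :
  reflect (exists2 x, ~~ outer x & flip (face x) M1 M2) (res_adj a s o M1 M2).
Proof.
have E x : ((M1 :\: M2) :|: (M2 :\: M1) == face x :|: [set a y | y in face x]) <->
    flip (face x) M1 M2.
  have memE d : (d \in face x :|: [set a y | y in face x]) = (d \in face x) (+) (a d \in face x).
    rewrite inE -{2}(aK G d) mem_imset; last exact: perm_inj.
    by case: (boolP (d \in _)) => // /face_a_disjoint ->.
  have symE d : (d \in (M1 :\: M2) :|: (M2 :\: M1)) = (d \in M1) (+) (d \in M2).
    by rewrite !inE; do 2!case: (d \in _).
  by split=> [/eqP E d|E]; [rewrite -symE E memE|apply/eqP/setP=> d; rewrite symE memE].
apply: (iffP exists_inP) => [[F FI EF]|[x nx /E H]]; last by exists (face x); rewrite ?inner_face.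
have /imsetP[x _ Fx] : F \in faces a s by case/setD1P: FI.
by rewrite Fx in FI EF; exists x; [rewrite -inner_face|apply/E].
Qed.
End Matchings.

Section Orientation.
Variables (D : finType) (a s : {perm D}) (o : D).
Hypothesis C : CERS a s o.
Variable c : D -> bool.
Hypothesis (cs : forall x, c (s x) = c x) (ca : forall x, c (a x) = ~~ c x).

Local Notation face x := (porbit (phi a s) x).
Local Notation outer x := (x \in outer_face a s o).
Local Notation G := (proj1 C).
Local Notation chord := (is_chord a s o).

(* Each inner face F is an even cycle with two perfect matchings, the colour classes of its
   darts; [g F] selects one. *)
Definition selected (g : {set D} -> bool) d := outer d || (c d == g (face d)).
Definition glued_matching g := [set d | selected g d && selected g (a d)].

(** An edge is kept when both sides select it, the outer face selecting everything. Since [a x] and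
    [s x] have opposite colours on a common face, exactly one of them is selected when that face is
    inner. In degree three the count could only fail by keeping both outer edges, which requires the
    chord to be rejected on both sides. *)
Lemma glued_matching_perfect g :
  (forall x, chord x -> selected g x || selected g (a x)) ->
  perfect_matching a s (glued_matching g).
Proof.
move=> clause; apply/(perfect_matchingP C); split=> [x|d od].
  by rewrite !inE (aK G) andbC.
have sel_a x : ~~ outer (s x) -> selected g (a x) = ~~ selected g (s x).
  move=> ns; rewrite /selected (outer_a G) (negPf ns) /= (face_a G) ca cs.
  by case: (c x) (g _) => [][].
have sel_o x : outer x -> selected g x by rewrite /selected => ->.
have ns := outer_s C od; split=> E; rewrite !inE sel_a // (sel_o d) //=.
  by rewrite (sel_o (a (s d))) ?(outer_a G) ?E //; case: (selected _ _).
have nss := outer_ss C E od; rewrite (sel_o (a (s (s d)))) ?(outer_a G) ?E //.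
have := clause (s d); rewrite /is_chord ns (outer_a G) nss sel_a // => /(_ isT).
by case: (selected _ _) (selected _ _) => [][].
Qed.

(** Root the dual tree at the given face and let every other face select its chord towards the root.
    Every chord is then selected on some side whatever the root selects, so the two choices at the
    root give matchings differing by its boundary. *)
Lemma face_flip x0 : ~~ outer x0 -> exists M1 M2 : {set D},
  [/\ perfect_matching a s M1, perfect_matching a s M2 & flip a (face x0) M1 M2].
Proof.
move=> nx0; set F0 := face x0; have F0I : F0 \in inner_faces a s o by rewrite inner_face.
have [_ conn acyc] := proj2 C.
have dual_irr : irreflexive (dual_adj a) by move=> F; rewrite /dual_adj eqxx.
have [R [R_fun R_tot R_root]] :=
  acyclic_orientation (dual_adj_sym C) dual_irr F0I conn acyc.
(* Away from the root this is the colour of the chord to the parent; [R_fun] and [chord_faces_inj]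
   make that chord unique. *)
pose g b F := if F == F0 then b else [exists x in F, [&& chord x, R F (face (a x)) & c x]].
have R_sel b x : chord x -> R (face x) (face (a x)) -> face x != F0 -> selected (g b) x.
  move=> cx Rx nF; rewrite /selected /g (negPf nF); apply/orP; right.
  apply/eqP; apply/idP/exists_inP => [cx1|[y yx /and3P[cy Ry c1]]].
    by exists x; rewrite ?porbit_id // cx Rx.
  have Ef := porbit_eq_of_mem yx.
  by rewrite (chord_faces_inj C cx cy) ?Ef // (R_fun _ _ _ Rx Ry).
(* The neighbours of the root select the chords they share with it, so the bit [b] alone decides the
   edges of the root. *)
have sel_root b x : chord x -> face x = F0 -> selected (g b) (a x).
  move=> cx Ex; have cax : chord (a x) by rewrite (chord_a C).
  apply: R_sel => //; last by rewrite -Ex (no_bridge G).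
  rewrite (aK G) Ex; apply: R_root; first by rewrite inner_face; case/andP: cx.
  by rewrite (dual_adj_sym C) -Ex (dual_adj_a C).
have clause b x : chord x -> selected (g b) x || selected (g b) (a x).
  move=> cx; have cax : chord (a x) by rewrite (chord_a C).
  have [Ex|nx] := eqVneq (face x) F0; first by rewrite sel_root ?orbT.
  have [Eax|nax] := eqVneq (face (a x)) F0.
    by have := sel_root b _ cax Eax; rewrite (aK G) => ->.
  have := R_tot (face x) (face (a x)); rewrite !inner_face.
  case/andP: (cx) => -> -> /(_ isT isT (dual_adj_a C x)) /orP[] H.
    by rewrite R_sel.
  by rewrite (R_sel b (a x)) ?orbT ?(aK G).
exists (glued_matching (g true)), (glued_matching (g false)); split.
- exact/glued_matching_perfect/clause.
- exact/glued_matching_perfect/clause.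
have sel_out x : face x != F0 -> selected (g true) x = selected (g false) x.
  by rewrite /selected /g => /negPf->.
have sel_in x : face x = F0 -> selected (g true) x = ~~ selected (g false) x.
  move=> Ex; rewrite /selected /g Ex eqxx (outer_eq _ Ex) (negPf nx0) /=.
  by case: (c x).
have sel_a b x : face x = F0 -> selected (g b) (a x).
  move=> Ex; have nx : ~~ outer x by rewrite (outer_eq _ Ex).
  have [ox|nax] := boolP (outer (a x)); first by rewrite /selected ox.
  by apply: sel_root; rewrite ?/is_chord ?nx.
move=> d; rewrite !inE !mem_face -/F0.
have [Ed|nd] := eqVneq (face d) F0.
  have -> : (face (a d) == F0) = false by rewrite -Ed; exact: negbTE (no_bridge G d).
  by rewrite !sel_a // !andbT sel_in //; case: (selected _ _).
have [Ead|nad] := eqVneq (face (a d)) F0; last by rewrite !sel_out // addbb.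
have E b : selected (g b) d by rewrite -(aK G d) sel_a.
rewrite !E /= sel_in //.
by case: (selected _ _).
Qed.

End Orientation.

(** * Aligned chords and daisy cubes *)

(** The coordinates are characteristic vectors. The family of sets is closed under subsets, so its
    whole image can serve as the generating set. *)
Lemma daisy_cube_of_family (V T : finType) (P : {set V}) (E : rel V) (g : V -> {set T}) :
    {in P &, injective g} ->
    (forall M, M \in P -> forall S : {set T}, S \subset g M -> exists2 M', M' \in P & g M' = S) ->
    {in P &, forall u v, E u v = (#|(g u :\: g v) :|: (g v :\: g u)| == 1)} ->
  is_daisy_cube P E.
Proof.
move=> g_inj g_down E_g.
pose f u : {ffun 'I_#|T| -> bool} := [ffun i => enum_val i \in g u].
have fE u x : f u (enum_rank x) = (x \in g u) by rewrite ffunE enum_rankK.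
exists #|T|, (f @: P), f; split.
- move=> u v uP vP E2; apply: g_inj => //; apply/setP=> x; by rewrite -!fE E2.
- apply/setP=> w; rewrite inE; apply/idP/exists_inP => [wP|[w' /imsetP[u uP ->] /forallP le]].
    by exists w => //; apply/forallP => i; apply/implyP.
  have [|v vP gv] := g_down u uP [set x | w (enum_rank x)].
    apply/subsetP=> x; rewrite inE => wx; rewrite -fE.
    by have := le (enum_rank x); rewrite wx.
  apply/imsetP; exists v => //; apply/ffunP => i.
  by rewrite ffunE gv inE enum_valK.
- move=> u v uP vP; rewrite E_g // /hadj; congr (_ == 1).
  rewrite -(card_imset _ (@enum_val_inj _ T)); apply: eq_card => x.
  apply/idP/imsetP => [|[i]]; last first.
    by rewrite !inE !ffunE => + ->; do 2!case: (_ \in _).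
  by move=> H; exists (enum_rank x); rewrite ?enum_rankK // !inE !fE; move: H;
    rewrite !inE; do 2!case: (_ \in _).
Qed.

Section Daisy.
Variables (D : finType) (a s : {perm D}) (o : D).
Hypothesis C : CERS a s o.
Variable c : D -> bool.
Hypothesis (cs : forall x, c (s x) = c x) (ca : forall x, c (a x) = ~~ c x).

Local Notation ph := (phi a s).
Local Notation face x := (porbit (phi a s) x).
Local Notation vert x := (porbit s x).
Local Notation outer x := (x \in outer_face a s o).
Local Notation G := (proj1 C).
Local Notation chord := (is_chord a s o).

Definition aligned := forall x y, chord x -> chord y -> face x = face y -> c x = c y.

(** Each face selects the common colour of its chords, so a chord is selected from both sides. A
    face without chords selects [false], an arbitrary choice. *)
Lemma aligned_matching : aligned ->
  exists2 M, perfect_matching a s M & forall x, chord x -> x \in M.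
Proof.
move=> al; pose g (F : {set D}) := [exists x in F, chord x && c x].
have gE x : chord x -> g (face x) = c x.
  move=> cx; apply/exists_inP/idP => [[y yx /andP[cy]]|cx1].
    by rewrite (al y x) // (porbit_eq_of_mem yx).
  by exists x; rewrite ?porbit_id ?cx.
have sel x : chord x -> selected a s o c g x.
  by move=> cx; rewrite /selected gE // eqxx orbT.
exists (glued_matching a s o c g).
  by apply: glued_matching_perfect => // x /sel ->.
by move=> x cx; rewrite inE !sel ?(chord_a C).
Qed.

Lemma face_ext (S1 S2 : {set {set D}}) :
  S1 \subset inner_faces a s o -> S2 \subset inner_faces a s o ->
  (forall x, (face x \in S1) = (face x \in S2)) -> S1 = S2.
Proof.
move=> /subsetP s1 /subsetP s2 E; apply/setP=> F.
have [/imsetP[x _ ->]|nF] := boolP (F \in faces a s); first exact: E.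
have nI S : {subset S <= inner_faces a s o} -> (F \in S) = false.
  by move=> sub; apply: contraNF nF => /sub /setD1P[].
by rewrite !nI.
Qed.

Lemma outer_notin (S : {set {set D}}) x : S \subset inner_faces a s o -> outer x ->
  (face x \in S) = false.
Proof.
by move=> /subsetP sub ox; apply: contraTF ox => /sub; rewrite inner_face.
Qed.

(** * Perfect matchings as independent sets of inner faces *)

Section Shift.
Variable M0 : {set D}.
Hypothesis M0_perfect : perfect_matching a s M0.
Hypothesis M0_chord : forall x, chord x -> x \in M0.

Definition shift (S : {set {set D}}) :=
  [set d | (d \in M0) (+) ((face d \in S) (+) (face (a d) \in S))].

(** At a vertex of degree three [M0] uses the chord. Adding the boundary of one of the two inner
    faces there moves the matched edge; adding both puts all three edges in the set. *)
Lemma shift_perfect (S : {set {set D}}) : S \subset inner_faces a s o ->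
  reflect (forall x, chord x -> ~~ ((face x \in S) && (face (a x) \in S)))
          (perfect_matching a s (shift S)).
Proof.
move=> SI; have [M0a M0o] := perfect_matchingP C _ M0_perfect.
have deg3 d : outer d -> s (s (s d)) = d -> chord (s d).
  by move=> od s3; rewrite /is_chord (outer_s C) // (outer_a G) outer_ss.
have in3 d : outer d -> s (s (s d)) = d ->
    [/\ (d \in M0) = false, s d \in M0 & (s (s d) \in M0) = false].
  move=> od s3; have [_ /(_ s3)] := M0o d od; rewrite (M0_chord (deg3 d od s3)).
  by case: (d \in M0); case: (s (s d) \in M0).
have notS x : outer x -> (face x \in S) = false by move=> ox; exact: outer_notin SI ox.
have E3 d : outer d -> s (s (s d)) = d ->
  ((d \in shift S) + (s d \in shift S) + (s (s d) \in shift S) == 1) =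
  ~~ ((face (s d) \in S) && (face (a (s d)) \in S)).
  move=> od s3; have [i0 i1 i2] := in3 d od s3.
  rewrite !inE i0 i1 i2 !(face_a G) s3 (notS d) //.
  by case: (_ \in S); case: (_ \in S).
apply: (iffP (perfect_matchingP C _)) => [[_ H] x cx|H].
  have [oss s3] := chord_vert C cx; have [_ H3] := H _ oss.
  have s3' : s (s (s (s (s x)))) = s (s x) by rewrite s3.
  by have := E3 _ oss s3'; rewrite H3 // eqxx s3 => <-.
split=> [x|d od]; first by rewrite !inE M0a (aK G) (addbC (_ \in S)).
split=> E; last by apply/eqP; rewrite E3 // H // deg3.
have [/(_ E) + _] := M0o d od; rewrite !inE !(face_a G) E (notS d) //.
by case: (d \in M0); case: (s d \in M0); case: (_ \in S).
Qed.

Lemma shift_inj (S1 S2 : {set {set D}}) :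
  S1 \subset inner_faces a s o -> S2 \subset inner_faces a s o -> shift S1 = shift S2 -> S1 = S2.
Proof.
move=> s1 s2 /setP E; apply: face_ext => // x; apply/eqP.
pose f d := (face d \in S1) (+) (face d \in S2).
have : f x = f o.
  apply: (face_const G) => d; rewrite /f ?(face_ph a s) //.
  have := E d; rewrite !inE.
  by case: (d \in M0) (_ \in S1) (_ \in S1) (_ \in S2) (_ \in S2) => [][][][][].
rewrite /f !(outer_notin (x := o)) ?porbit_id //.
by case: (_ \in S1) (_ \in S2) => [][].
Qed.

Lemma sum_vert M d : perfect_matching a s M ->
  \big[addb/false]_(x in vert d) (x \in M) = true.
Proof.
case/andP=> _ /forallP/(_ d) /cards1P[y Ey].
rewrite (eq_bigr (fun x => if x \in M then true else false)); last by move=> x _; case: ifP.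
rewrite -big_mkcondr (eq_bigl (mem [set y])) ?big_set1 // => x.
by rewrite /= -Ey inE.
Qed.

Lemma shift_surj M : perfect_matching a s M ->
  exists S : {set {set D}}, (S \subset inner_faces a s o) && (M == shift S).
Proof.
move=> PM; have [d|d|f [fp fE]] := face_exact G (Z := fun d => (d \in M) (+) (d \in M0)).
- by rewrite !(perfect_matching_a C).
- by rewrite big_split /= !sum_vert.
(* Adding [f o] picks, of the two face sets with this boundary, the one without the outer face. *)
pose S := [set F in inner_faces a s o | [exists x in F, f x (+) f o]].
have SE x : (face x \in S) = f x (+) f o.
  rewrite inE inner_face; apply/andP/idP => [[_ /exists_inP[y yx]]|H].
    by rewrite (porbit_inv_fun fp yx).
  split; last by apply/exists_inP; exists x; rewrite ?porbit_id.
  by apply: contraL H => /(porbit_inv_fun fp) ->; rewrite addbb.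
exists S; apply/andP; split; first by apply/subsetP => F; rewrite inE => /andP[].
apply/eqP/setP=> d; rewrite inE !SE.
have := fE d; by case: (d \in M) (d \in M0) (f d) (f (a d)) (f o) => [][][][][].
Qed.

(** The sum of [S1], [S2] and the face of [x] has empty boundary and omits the outer face, so it is
    empty. *)
Lemma flip_shift (S1 S2 : {set {set D}}) x :
  S1 \subset inner_faces a s o -> S2 \subset inner_faces a s o -> ~~ outer x ->
  flip a (face x) (shift S1) (shift S2) <-> (S1 :\: S2) :|: (S2 :\: S1) = [set face x].
Proof.
move=> s1 s2 nx.
pose f d := (face d \in S1) (+) (face d \in S2) (+) (face d == face x).
have flipE : flip a (face x) (shift S1) (shift S2) <-> forall d, f (a d) = f d.
  split=> H d; have := H d; rewrite /f !inE !mem_face.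
    by case: (d \in M0) (_ \in S1) (_ \in S1) (_ \in S2) (_ \in S2) (_ == _) (_ == _)
      => [][][][][][][].
  by case: (d \in M0) (_ \in S1) (_ \in S1) (_ \in S2) (_ \in S2) (_ == _) (_ == _)
    => [][][][][][][].
have fo : f o = false.
  rewrite /f !outer_notin ?porbit_id // eq_sym -mem_face.
  exact: negbTE nx.
split=> [/flipE fa|ST].
  apply: face_ext => [||y]; first by rewrite subUset !(subset_trans (subsetDl _ _)).
    by rewrite sub1set inner_face.
  have fy : f y = false by rewrite -fo; apply: (face_const G) => // d; rewrite /f (face_ph a s).
  by move: fy; rewrite /f !inE; case: (_ \in S1) (_ \in S2) (_ == _) => [][][].
apply/flipE => d.
have f0 y : f y = false.
  have /setP/(_ (face y)) := ST; rewrite /f !inE.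
  by case: (_ \in S1) (_ \in S2) (_ == _) => [][][].
by rewrite !f0.
Qed.

Lemma shift_daisy : is_daisy_cube (perfect_matchings a s) (res_adj a s o).
Proof.
(* On perfect matchings the default [set0] is never taken, by [shift_surj]. *)
pose g M := if [pick S : {set {set D}} | (S \subset inner_faces a s o) && (M == shift S)]
            is Some T then T else set0.
have gP M : perfect_matching a s M -> g M \subset inner_faces a s o /\ M = shift (g M).
  move/shift_surj=> [S HS]; rewrite /g.
  by case: pickP => [T /andP[? /eqP]|/(_ S)]; rewrite ?HS.
have gK (S : {set {set D}}) : S \subset inner_faces a s o -> perfect_matching a s (shift S) ->
    g (shift S) = S.
  by move=> SI /gP[gI E]; apply: shift_inj.
apply: (daisy_cube_of_family (g := g)).
- by move=> M N; rewrite !inE => /gP[_ EM] /gP[_ EN] E; rewrite EM E.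
- move=> M; rewrite inE => PM S sub; have [MI EM] := gP M PM.
  have SI := subset_trans sub MI.
  have PS : perfect_matching a s (shift S).
    apply/shift_perfect => // x cx; rewrite EM in PM.
    apply: contra (elimT (shift_perfect MI) PM x cx).
    by move/subsetP: sub => sub /andP[/sub-> /sub->].
  by exists (shift S); rewrite ?inE ?gK.
- move=> M N; rewrite !inE => /gP[MI EM] /gP[NI EN].
  rewrite {1}EM {1}EN; apply/(res_adjP C)/cards1P => [[x nx /flip_shift H]|[F EF]].
    by exists (face x); apply: H.
  have FI : F \in inner_faces a s o.
    have : F \in (g M :\: g N) :|: (g N :\: g M) by rewrite EF set11.
    rewrite inE => /orP[]/setDP[FS _]; first exact: (subsetP MI).
    exact: (subsetP NI).
  have /imsetP[x _ Ex] : F \in faces a s by case/setD1P: FI.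
  have nx : ~~ outer x by rewrite -inner_face -Ex.
  by exists x => //; apply/flip_shift => //; rewrite -Ex.
Qed.
End Shift.

Lemma aligned_daisy : aligned -> is_daisy_cube (perfect_matchings a s) (res_adj a s o).
Proof. by case/aligned_matching => M; apply: shift_daisy. Qed.

End Daisy.

(** * From daisy cubes to aligned chords *)

Section DaisyConverse.
Variables (D : finType) (a s : {perm D}) (o : D).
Hypothesis C : CERS a s o.
Variable c : D -> bool.
Hypothesis (cs : forall x, c (s x) = c x) (ca : forall x, c (a x) = ~~ c x).

Local Notation ph := (phi a s).
Local Notation face x := (porbit (phi a s) x).
Local Notation vert x := (porbit s x).
Local Notation outer x := (x \in outer_face a s o).
Local Notation G := (proj1 C).
Local Notation chord := (is_chord a s o).

Lemma flip_sym (F M1 M2 : {set D}) : flip a F M1 M2 -> flip a F M2 M1.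
Proof. by move=> H d; rewrite -H addbC. Qed.

Lemma flip_det (F M N1 N2 : {set D}) : flip a F M N1 -> flip a F M N2 -> N1 = N2.
Proof.
move=> H1 H2; apply/setP=> d; have := H1 d; rewrite -H2.
by case: (d \in M) (d \in N1) (d \in N2) => [][][].
Qed.

(** Around a square the four boundaries sum to zero, hence so do the four faces. As the diagonals
    are nondegenerate, the face of [x] differs from those of [y1] and [y2], so only that of [y] can
    cancel it. *)
Lemma flip_square x y1 y2 y (M1 M2 N1 N2 : {set D}) :
  ~~ outer x -> ~~ outer y1 -> ~~ outer y2 -> ~~ outer y ->
  flip a (face x) M1 M2 -> flip a (face y1) M1 N1 -> flip a (face y2) M2 N2 ->
  flip a (face y) N1 N2 -> M1 != N2 -> M2 != N1 -> face y = face x.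
Proof.
move=> nx ny1 ny2 ny Hx H1 H2 H nMN nMN'.
pose f d := ((d \in face x) (+) (d \in face y1)) (+) ((d \in face y2) (+) (d \in face y)).
have fo z : ~~ outer z -> (o \in face z) = false by rewrite porbit_sym => /negbTE.
have fx : f x = false.
  have -> : false = f o by rewrite /f !fo.
  apply: (face_const G) => d; first by rewrite /f !mem_face !face_ph.
  have := Hx d; have := H1 d; have := H2 d; have := H d; rewrite /f.
  case: (d \in M1) (d \in M2) (d \in N1) (d \in N2) => [][][][];
  do 4![case: (d \in _); case: (a d \in _) => //].
have x1 : (x \in face y1) = false.
  apply: contraNF nMN'; rewrite mem_face => /eqP E; apply/eqP.
  by apply: flip_det Hx _; rewrite E.
have x2 : (x \in face y2) = false.
  apply: contraNF nMN; rewrite mem_face => /eqP E; apply/eqP.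
  by apply: flip_det (flip_sym Hx) _; rewrite E.
move: fx; rewrite /f porbit_id x1 x2 /= => /negbFE.
by rewrite mem_face => /eqP.
Qed.

(** Consecutive edges of the face share a vertex, so [M] cannot contain both; if it contained
    neither, [M'] would contain both. *)
Lemma flip_alternates x (M M' : {set D}) d : perfect_matching a s M -> perfect_matching a s M' ->
  flip a (face x) M M' -> d \in face x -> (ph d \in M) = ~~ (d \in M).
Proof.
move=> PM PM' H dx; rewrite -(perfect_matching_a C d PM).
have Ev : vert (ph d) = vert (a d) by rewrite vert_ph.
have ne : ph d != a d by rewrite /phi phiE (s_neq G).
have phx : ph d \in face x by rewrite mem_face face_ph -mem_face.
have := H (ph d); have := H (a d).
rewrite (aK G) dx phx !(face_a_disjoint C) //=.
case: (boolP (ph d \in M)) => [pM|pM]; case: (boolP (a d \in M)) => [aM|aM] //=.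
  by rewrite (perfect_matching_inj PM pM aM Ev) eqxx in ne.
move=> aM' pM'.
by rewrite (perfect_matching_inj PM' pM' aM' Ev) eqxx in ne.
Qed.

Lemma all_flippable_aligned M : perfect_matching a s M ->
  (forall x, ~~ outer x -> exists2 M', perfect_matching a s M' & flip a (face x) M M') ->
  aligned a s o c.
Proof.
move=> PM fl.
have alt x : ~~ outer x -> (ph x \in M) = ~~ (x \in M).
  by move=> /fl[M' PM' H]; apply: flip_alternates PM PM' H (porbit_id _ _).
have chordM x : chord x -> x \in M.
  (* If a chord were missing, alternation on its two faces would force both other edges at its
     vertex into [M]. *)
  move=> cx; case/andP: (cx) => nx nax; apply/negPn/negP => xM.
  have [oss s3] := chord_vert C cx.
  have s1M : s x \in M by rewrite -(ph_a G) alt // (perfect_matching_a C).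
  have nass : ~~ outer (a (s (s x))) by rewrite (outer_a G) s3.
  have := alt _ nass; rewrite (ph_a G) s3 (negPf xM) (perfect_matching_a C) // => /esym/negbFE s2M.
  have := perfect_matching_inj PM s2M s1M; rewrite !vert_s => /(_ erefl) E.
  by have := s_neq G (s x); rewrite E eqxx.
move=> x y cx cy Exy.
(* Membership in [M] and colour both switch at each step along the face, so their sum is
   constant. *)
have H i : ~~ outer ((ph ^+ i)%g y) /\ ((ph ^+ i)%g y \in M) (+) c ((ph ^+ i)%g y) = ~~ c y.
  elim: i => [|i [no IH]]; first by rewrite expg0 perm1 chordM //; case/andP: cy.
  rewrite expgSr permM outer_ph alt // -IH; split=> //.
  by rewrite {2}/phi phiE cs ca addNb addbN negbK.
have /porbitP[i Ex] : x \in face y by rewrite mem_face Exy.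
by have [_] := H i; rewrite -Ex chordM // => /negb_inj.
Qed.

Lemma daisy_flippable : is_daisy_cube (perfect_matchings a s) (res_adj a s o) ->
  exists2 M, perfect_matching a s M &
    forall x, ~~ outer x -> exists2 M', perfect_matching a s M' & flip a (face x) M M'.
Proof.
case=> n [X [f [f_inj f_im f_adj]]].
pose upd i b (w : {ffun 'I_n -> bool}) : {ffun 'I_n -> bool} :=
  [ffun j => if j == i then b else w j].
(* The image of [f] is closed downwards. *)
have pre M w : perfect_matching a s M -> leB w (f M) ->
    exists2 N, perfect_matching a s N & f N = w.
  move=> PM lew; have : w \in f @: perfect_matchings a s.
    have : f M \in daisy_vertices X by rewrite -f_im imset_f // inE.
    rewrite f_im !inE => /exists_inP[x xX /forallP lex]; apply/exists_inP; exists x => //.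
    apply/forallP => i; apply/implyP => wi.
    by apply: implyP (lex i) _; apply: implyP (forallP lew i) wi.
  by case/imsetP=> N; rewrite inE => PN ->; exists N.
have res M N : perfect_matching a s M -> perfect_matching a s N ->
    hadj (f M) (f N) -> exists2 y, ~~ outer y & flip a (face y) M N.
  by move=> PM PN; rewrite -f_adj ?inE // => /(res_adjP C).
have hadj_upd (w : {ffun 'I_n -> bool}) j : hadj w (upd j (~~ w j) w).
  apply/cards1P; exists j; apply/setP=> k; rewrite !inE ffunE.
  by have [->|_] := eqVneq k j; [case: (w j)|rewrite eqxx].
(* Induction on the number of ones of [f M1]: clearing a coordinate [j] in both ends of the edge
   gives a square, and [flip_square] keeps the flipped face. *)
have down k x M1 M2 i : ~~ outer x -> perfect_matching a s M1 -> perfect_matching a s M2 ->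
    flip a (face x) M1 M2 -> f M1 i = false -> f M2 = upd i true (f M1) ->
    #|[set j | f M1 j]| = k ->
  exists N1 N2, [/\ perfect_matching a s N1, perfect_matching a s N2,
    flip a (face x) N1 N2 & f N1 = [ffun => false]].
  move=> nx; elim: k M1 M2 => [|k IH] M1 M2 PM1 PM2 H f1i f2 card_f1.
    exists M1, M2; split=> //; apply/ffunP => j; rewrite ffunE.
    by have /setP/(_ j) := cards0_eq card_f1; rewrite !inE.
  have /card_gt0P[j] : 0 < #|[set j | f M1 j]| by rewrite card_f1.
  rewrite inE => f1j; have nji : j != i by apply: contraTneq f1j => ->; rewrite f1i.
  have f2j : f M2 j by rewrite f2 ffunE (negPf nji).
  have le_upd M : leB (upd j false (f M)) (f M).
    by apply/forallP => l; rewrite ffunE; case: eqP => // _; rewrite implybb.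
  have [N1 PN1 g1] := pre _ _ PM1 (le_upd M1); have [N2 PN2 g2] := pre _ _ PM2 (le_upd M2).
  have g2' : f N2 = upd i true (f N1).
    apply/ffunP => l; rewrite g2 g1 f2 !ffunE.
    by have [->|//] := eqVneq l j; rewrite (negPf nji).
  have g1i : f N1 i = false by rewrite g1 ffunE f1i if_same.
  have [|y1 ny1 H1] := res _ _ PM1 PN1.
    by rewrite g1; have := hadj_upd (f M1) j; rewrite f1j.
  have [|y2 ny2 H2] := res _ _ PM2 PN2.
    by rewrite g2; have := hadj_upd (f M2) j; rewrite f2j.
  have [|y ny HN] := res _ _ PN1 PN2.
    by rewrite g2'; have := hadj_upd (f N1) i; rewrite g1i.
  have Ey : face y = face x.
    apply: (flip_square nx ny1 ny2 ny H H1 H2 HN).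
      by apply: contraFneq f1i => ->; rewrite g2' ffunE eqxx.
    by apply: contraFneq g1i => <-; rewrite f2 ffunE eqxx.
  apply: (IH N1 N2) => //; first by rewrite -Ey.
  apply/eqP; rewrite -eqSS -card_f1 (cardsD1 j [set l | f M1 l]) inE f1j add1n eqSS; apply/eqP.
  by apply: eq_card => l; rewrite !inE g1 ffunE; case: eqP.
have flip0 x : ~~ outer x -> exists N1 N2, [/\ perfect_matching a s N1, perfect_matching a s N2,
    flip a (face x) N1 N2 & f N1 = [ffun => false]].
  move=> nx; have [M1 [M2 [PM1 PM2 H]]] := face_flip C cs ca nx.
  have : res_adj a s o M1 M2 by apply/(res_adjP C); exists x.
  rewrite f_adj ?inE // => /cards1P[i Ei].
  have Ej j : (f M1 j != f M2 j) = (j == i) by have /setP/(_ j) := Ei; rewrite !inE.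
  case f1i: (f M1 i).
    apply: (down _ x M2 M1 i nx PM2 PM1 (flip_sym H) _ _ erefl).
      by have := Ej i; rewrite eqxx f1i; case: (f M2 i).
    apply/ffunP => j; rewrite ffunE; case: eqVneq => [->|/negPf nj] //.
    by apply/eqP; rewrite -[_ == _]negbK Ej nj.
  apply: (down _ x M1 M2 i nx PM1 PM2 H f1i _ erefl).
  apply/ffunP => j; rewrite ffunE; case: eqVneq => [->|/negPf nj] //.
    by have := Ej i; rewrite eqxx f1i; case: (f M2 i).
  by apply/eqP; rewrite eq_sym -[_ == _]negbK Ej nj.
have [/set0Pn[F FI] _ _] := proj2 C.
have /imsetP[x _ Ex] : F \in faces a s by case/setD1P: FI.
have nx : ~~ outer x by rewrite -inner_face -Ex.
(* By injectivity of [f], the matching at the zero vector is the same for every face. *)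
have [M [_ [PM _ _ fM]]] := flip0 x nx; exists M => // y ny.
have [N1 [N2 [PN1 PN2 H fN]]] := flip0 y ny; exists N2 => //.
by rewrite (f_inj M N1) ?inE // fN.
Qed.

Lemma daisy_aligned : is_daisy_cube (perfect_matchings a s) (res_adj a s o) -> aligned a s o c.
Proof. by case/daisy_flippable => M; apply: all_flippable_aligned. Qed.

End DaisyConverse.

(** * Line-graph distance between chords *)

Section LineDistance.
Variables (D : finType) (a s : {perm D}) (o : D).
Hypothesis C : CERS a s o.
Variable c : D -> bool.
Hypothesis (cs : forall x, c (s x) = c x) (ca : forall x, c (a x) = ~~ c x).

Local Notation ph := (phi a s).
Local Notation face x := (porbit (phi a s) x).
Local Notation vert x := (porbit s x).
Local Notation edge x := (porbit a x).
Local Notation outer x := (x \in outer_face a s o).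
Local Notation G := (proj1 C).
Local Notation chord := (is_chord a s o).

Lemma mem_edge x y : (x \in edge y) = (x == y) || (x == a y).
Proof. by rewrite (porbit_invol (aK G)) !inE. Qed.

Lemma vadj_step x v : v \in vertices s -> vadj a (vert x) v ->
  exists2 z, vert z = vert x & v = vert (a z).
Proof.
case/imsetP=> y _ -> /exists_inP[z zx azy]; exists z; first exact: porbit_eq_of_mem.
by rewrite (porbit_eq_of_mem azy).
Qed.

(** One line-graph step is made at each of the [(size p).+1] vertices; it is saved when the two
    edges there coincide, hence the inequality. *)
Lemma path_lwalk x y p : path (vadj a) (vert x) p -> {subset p <= vertices s} ->
  last (vert x) p = vert y -> exists2 j, j <= (size p).+1 & lwalk a s j (edge x) (edge y).
Proof.
have ladjI z w : vert z = vert w -> edge z != edge w -> ladj s (edge z) (edge w).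
  move=> E ne; rewrite /ladj ne; apply/exists_inP; exists z; rewrite ?porbit_id //.
  by apply/exists_inP; exists w; rewrite ?porbit_id ?E.
elim: p x => [|v p IH] x /=.
  move=> _ _ E; have [Ee|ne] := eqVneq (edge x) (edge y); first by exists 0 => //=; apply/eqP.
  by exists 1 => //=; apply/exists_inP; exists (edge y); rewrite ?mem_porbits // ladjI /=.
case/andP=> xv pth sub.
have vV : v \in vertices s by rewrite sub ?mem_head.
have {xv}[z zx Ev] := vadj_step vV xv; rewrite Ev in pth *; move=> lst.
have [|j le_j wj] := IH _ pth _ lst; first by move=> w wp; rewrite sub // inE wp orbT.
rewrite porbit_step in wj.
have [Ee|ne] := eqVneq (edge x) (edge z); first by exists j; rewrite ?Ee // leqW.
exists j.+1 => //=; apply/exists_inP; exists (edge z); rewrite ?mem_porbits //.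
by rewrite ladjI.
Qed.

Lemma lwalk_path k x y : lwalk a s k.+1 (edge x) (edge y) ->
  exists x' y' p, [/\ x' \in edge x, y' \in edge y, path (vadj a) (vert x') p,
    {subset p <= vertices s} & last (vert x') p = vert y' /\ size p <= k].
Proof.
elim: k x => [|k IH] x /exists_inP[e3 /imsetP[z _ ->]] /andP[/andP[_ /exists_inP[x' x'x]]].
  by move=> /exists_inP[y' y'y /eqP E] /= /eqP <-; exists x', y', [::].
move=> /exists_inP[z'' z''z /eqP E] /IH[z' [y' [p [z'z y'y pth sub [lst le_p]]]]].
(* If the walk enters and leaves the edge at the same end, the vertex path does not traverse it. *)
have [Ez|nz] := eqVneq z' z''.
  by exists x', y', p; rewrite E -Ez; split=> //; split=> //; apply: leqW.
have Ez : z' = a z''.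
  move: z'z z''z nz; rewrite !mem_edge => /orP[]/eqP-> /orP[]/eqP->; rewrite ?eqxx ?(aK G) //.
exists x', y', (vert z' :: p); split=> //=.
  rewrite pth andbT /vadj; apply/exists_inP; exists z''; rewrite ?E ?porbit_id //.
  by rewrite Ez porbit_id.
by move=> v; rewrite in_cons => /orP[/eqP->|/sub //]; exact: mem_porbits.
Qed.

Lemma colour_path x y p : path (vadj a) (vert x) p -> {subset p <= vertices s} ->
  last (vert x) p = vert y -> c y = c x (+) odd (size p).
Proof.
have c_vert z w : vert z = vert w -> c z = c w.
  by move/eqP; rewrite -mem_vert; apply: porbit_inv_fun.
elim: p x => [|v p IH] x /=; first by move=> _ _ /c_vert <-; rewrite addbF.
case/andP=> xv pth sub.
have vV : v \in vertices s by rewrite sub ?mem_head.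
have {xv}[z zx Ev] := vadj_step vV xv; rewrite Ev in pth *; move=> lst.
rewrite (IH _ pth _ lst) ?ca; last by move=> w wp; rewrite sub // inE wp orbT.
by rewrite (c_vert _ _ zx) addNb addbN.
Qed.

(** The boundary of an arc telescopes to its two ends. Multiplicities are counted because no bound
    on [j] prevents the arc from wrapping around. *)
Lemma arc_boundary x j d :
  \big[addb/false]_(z in vert d)
     (odd (count_mem z (traject ph x j)) (+) odd (count_mem (a z) (traject ph x j))) =
  (vert d == vert x) (+) (vert d == vert (iter j ph x)).
Proof.
elim: j x => [|j IH] x; first by rewrite /= addbb big1.
rewrite iterSr (eq_bigr (fun z => ((z == x) (+) (z == a x)) (+)
  (odd (count_mem z (traject ph (ph x) j)) (+) odd (count_mem (a z) (traject ph (ph x) j))))).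
  rewrite big_split /= sum_edge IH !mem_vert vert_ph !(eq_sym (vert d)).
  by do 3!case: (_ == vert d).
move=> z _; rewrite /= !oddD !oddb (eq_sym x).
have -> : (x == a z) = (z == a x) by rewrite -(can_eq (aK G)) (aK G) eq_sym.
by do 2!case: (z == _); do 2!case: (odd _).
Qed.

Lemma traject_face_uniq x j : j <= #|face x| -> uniq (traject ph x j).
Proof.
move=> le_j; have := uniq_traject_porbit ph x.
by rewrite -(subnKC le_j) trajectD cat_uniq => /andP[].
Qed.

(* The walk together with the arc of the face bounds a set of inner faces; at [g] and at [h] it
   can only use the arc, so both answer whether it separates the face from the outer one. *)
Lemma path_separation x j p g h : j <= #|face x| -> ~~ outer x ->
    path (vadj a) (vert x) p -> {subset p <= vertices s} ->
    last (vert x) p = vert (iter j ph x) ->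
    g \in face x -> h \in face x -> outer (a g) -> outer (a h) ->
    (vert g \notin vert x :: p) || (vert (a g) \notin vert x :: p) ->
    (vert h \notin vert x :: p) || (vert (a h) \notin vert x :: p) ->
  (g \in traject ph x j) = (h \in traject ph x j).
Proof.
move=> le_j nx pth sub lst gx hx oag oah vg vh.
have [Z [Za Zs Zp]] := path_chain G (mem_porbits s x) pth sub.
pose A z := odd (count_mem z (traject ph x j)) (+) odd (count_mem (a z) (traject ph x j)).
have [d|d|f [fp fE]] := face_exact G (Z := fun d => Z d (+) A d).
- by rewrite Za /A (aK G) (addbC (odd _)).
- by rewrite big_split /= arc_boundary Zs lst addbb.
have T_face z : z \in traject ph x j -> z \in face x.
  by case/trajectP=> i _ ->; rewrite -permX mem_porbit.
have T_uniq := traject_face_uniq le_j.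
suff key z : z \in face x -> outer (a z) ->
    (vert z \notin vert x :: p) || (vert (a z) \notin vert x :: p) ->
    (z \in traject ph x j) = f x (+) f o.
  by rewrite !key.
move=> zx oaz vz; have Zz : Z z = false.
  by case/orP: vz; apply: contraNF; [apply: Zp|rewrite -Za; apply: Zp].
have azT : (a z \in traject ph x j) = false.
  apply: contraNF nx => /T_face; rewrite mem_face => /eqP Ex.
  by rewrite -(outer_eq o Ex).
rewrite -(porbit_inv_fun fp zx) -(porbit_inv_fun fp oaz) -fE Zz /A.
by rewrite !count_uniq_mem // azT addbF oddb.
Qed.

(** Chords are disjoint, so at least one further dart lies between [x] and [y] on either arc of the
    face. *)
Lemma chords_in_face_index x y : chord x -> chord y -> face x = face y -> x != y ->
  exists2 j, y = iter j.+2 ph x & j.+3 < #|face x|.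
Proof.
move=> cx cy Exy nxy.
have noteq z w : chord z -> chord w -> vert (a z) = vert w -> face z != face w.
  move=> cz cw E; have cz' : chord (a z) by rewrite (chord_a C).
  by rewrite -(chord_vert_inj C cz' cw E) eq_sym (no_bridge G).
have : y \in face x by rewrite mem_face Exy.
rewrite porbit_traject => /trajectP[i lt_i Ey]; case: i lt_i Ey => [|[|j]] lt_j Ey.
- by rewrite Ey eqxx in nxy.
- by have := noteq _ _ cx cy; rewrite Ey /= -/ph vert_ph face_ph eqxx => /(_ erefl).
exists j => //; rewrite ltn_neqAle lt_j andbT; apply/eqP => En.
have := noteq _ _ cy cx; rewrite -vert_ph Exy eqxx => H.
by have := iter_porbit ph x; rewrite -En iterS -Ey => Ex; have := H (congr1 _ Ex).
Qed.

(** Apply [path_separation] to the darts following [x] and [y]. They border the outer face and start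
    at the heads, which the path misses; yet the arc from [x] to [y] contains only the first. *)
Lemma no_tail_path x y p : chord x -> chord y -> face x = face y -> x != y ->
    path (vadj a) (vert x) p -> {subset p <= vertices s} -> last (vert x) p = vert y ->
  vert (a x) \notin vert x :: p -> vert (a y) \notin vert x :: p -> False.
Proof.
move=> cx cy Exy nxy pth sub lst nax nay.
have [j Ey lt_j] := chords_in_face_index cx cy Exy nxy.
have oa z : chord z -> outer (a (ph z)).
  rewrite -(chord_a C) => /(chord_vert C)[+ _].
  by rewrite (outer_a G) /phi phiE.
have nx : ~~ outer x by case/andP: cx.
have le_j : j.+2 <= #|face x| by apply/ltnW/ltnW.
have gx : ph x \in face x by rewrite mem_face face_ph.
have hx : ph y \in face x by rewrite mem_face face_ph Exy.
rewrite -!(vert_ph a s) in nax nay; rewrite Ey in lst.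
have := path_separation le_j nx pth sub lst gx hx (oa x cx) (oa y cy)
  (introT orP (or_introl nax)) (introT orP (or_introl nay)).
have := traject_face_uniq lt_j; rewrite trajectSr rcons_uniq iterS -Ey => /andP[+ _].
rewrite trajectSr mem_rcons inE negb_or => /andP[_ /negbTE ->].
by rewrite /= !inE eqxx orbT.
Qed.

(** The mirror argument uses the darts preceding [x] and [y]: the arc starting at [ph x] and ending
    with [y] contains the second but not the first. *)
Lemma no_head_path x y p : chord x -> chord y -> face x = face y -> x != y ->
    path (vadj a) (vert (a x)) p -> {subset p <= vertices s} -> last (vert (a x)) p = vert (a y) ->
  vert x \notin vert (a x) :: p -> vert y \notin vert (a x) :: p -> False.
Proof.
move=> cx cy Exy nxy pth sub lst nax nay.
have [j Ey lt_j] := chords_in_face_index cx cy Exy nxy.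
(* At a chord [s] has order three, so this is the inverse of [ph]. *)
pose pre z := a (s (s z)).
have ph_pre z : chord z -> ph (pre z) = z.
  by case/(chord_vert C) => _ s3; rewrite /pre (ph_a G).
have oa z : chord z -> outer (a (pre z)).
  by case/(chord_vert C) => oz _; rewrite /pre (aK G).
have va z : vert (a (pre z)) = vert z by rewrite /pre (aK G) !vert_s.
have fa z : chord z -> face (pre z) = face z by move/ph_pre => {2}<-; rewrite face_ph.
have nx : ~~ outer x by case/andP: cx.
rewrite -!(vert_ph a s) in pth lst nax nay.
have gx : pre x \in face (ph x) by rewrite mem_face fa // face_ph.
have hx : pre y \in face (ph x) by rewrite mem_face fa // face_ph Exy.
have le_j : j.+2 <= #|face (ph x)| by rewrite face_ph; apply/ltnW/ltnW.
rewrite -(outer_ph a s o) in nx; rewrite Ey -iterS iterSr in lst.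
rewrite -(va x) in nax; rewrite -(va y) in nay.
have := path_separation le_j nx pth sub lst gx hx (oa x cx) (oa y cy)
  (introT orP (or_intror nax)) (introT orP (or_intror nay)).
have -> : pre y \in traject ph (ph x) j.+2.
  apply/trajectP; exists j => //; apply: (@perm_inj _ ph).
  by rewrite ph_pre // -iterSr -iterS.
move/trajectP=> [i lt_i Ei].
have := traject_face_uniq lt_j; rewrite trajectS cons_uniq => /andP[/negP[]].
rewrite -[x in x \in _](ph_pre x cx) Ei; apply/trajectP; exists i.+1; last by rewrite iterS.
by rewrite ltnS.
Qed.

Lemma lwalk_parity x y k : chord x -> chord y -> face x = face y -> x != y ->
    lwalk a s k (edge x) (edge y) ->
    (forall j, j < k -> ~~ lwalk a s j (edge x) (edge y)) ->
  odd k = c x (+) c y.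
Proof.
move=> cx cy Exy nxy; case: k => [/eqP E _|k wk min_k].
  have : y \in edge x by rewrite E porbit_id.
  rewrite mem_edge eq_sym (negPf nxy) => /eqP Ey.
  by have := no_bridge G x; rewrite -Ey Exy eqxx.
have [x' [y' [p [x'x y'y pth sub [lst le_p]]]]] := lwalk_path wk.
have Ex' := porbit_eq_of_mem x'x; have Ey' := porbit_eq_of_mem y'y.
(* Minimality of the line walk bounds the paths between any choice of ends of the two edges. *)
have short z w q : z \in edge x -> w \in edge y -> path (vadj a) (vert z) q ->
    {subset q <= vertices s} -> last (vert z) q = vert w -> k <= size q.
  move=> /porbit_eq_of_mem Ez /porbit_eq_of_mem Ew q1 q2 q3.
  have [j le_j] := path_lwalk q1 q2 q3; rewrite Ez Ew => wj.
  rewrite -ltnS; apply: leq_trans le_j; rewrite leqNgt.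
  by apply: contraL wj; apply: min_k.
have Ep : size p = k.
  by apply/eqP; rewrite eqn_leq le_p (short _ _ _ x'x y'y pth).
have ax'x : a x' \in edge x.
  by move: x'x; rewrite !mem_edge => /orP[]/eqP->; rewrite ?(aK G) eqxx ?orbT.
have ay'y : a y' \in edge y.
  by move: y'y; rewrite !mem_edge => /orP[]/eqP->; rewrite ?(aK G) eqxx ?orbT.
(* A path through the other end of its first edge could be started there and would be shorter; the
   same holds at the last edge. *)
have nax' : vert (a x') \notin vert x' :: p.
  apply/negP => H; case/splitPl: H pth sub lst Ep => p1 p2 Ev.
  rewrite cat_path last_cat size_cat Ev => /andP[_ p2th] sub lst.
  have p2sub : {subset p2 <= vertices s} by move=> z zp; apply: sub; rewrite mem_cat zp orbT.
  have := short _ _ _ ax'x y'y p2th p2sub lst.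
  case: p1 Ev {sub} => [/= E|v p1 _]; first by have := vert_a_neq G x'; rewrite E eqxx.
  by move=> le Ep; move: le; rewrite -Ep leqNgt /= addSn ltnS leq_addl.
have nay' : vert (a y') \notin vert x' :: p.
  apply/negP => H; case/splitPl: H pth sub lst Ep => p1 p2 Ev.
  rewrite cat_path last_cat size_cat Ev => /andP[p1th _] sub lst.
  have p1sub : {subset p1 <= vertices s} by move=> z zp; apply: sub; rewrite mem_cat zp.
  have := short _ _ _ x'x ay'y p1th p1sub Ev.
  case: p2 lst {sub} => [/= E|v p2 _]; first by have := vert_a_neq G y'; rewrite E eqxx.
  by move=> le Ep; move: le; rewrite -Ep leqNgt /= addnS ltnS leq_addr.
have := colour_path pth sub lst; rewrite Ep /=.
move: x'x y'y; rewrite !mem_edge => /orP[]/eqP Ex /orP[]/eqP Ey; subst x' y'.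
- by case: (no_tail_path cx cy Exy nxy pth sub lst).
- by rewrite ca => E; rewrite -[odd k](addKb (c x)) -E; case: (c x) (c y) => [][].
- by rewrite ca => ->; case: (c x) (odd k) => [][].
- by rewrite !(aK G) in nax' nay'; case: (no_head_path cx cy Exy nxy pth sub lst).
Qed.

Lemma lwalk_exists x y : exists k, lwalk a s k (edge x) (edge y).
Proof.
have [p [pth lst sub]] := vertices_path G (mem_porbits s x) (mem_porbits s y).
by have [j _ wj] := path_lwalk pth sub lst; exists j.
Qed.

Lemma ldist_even_colour x y : chord x -> chord y -> face x = face y -> x != y ->
  ldist_even a s (edge x) (edge y) <-> c x = c y.
Proof.
move=> cx cy Exy nxy; split=> [[k [ek wk min_k]]|E].
  have := lwalk_parity cx cy Exy nxy wk min_k; rewrite (negPf ek).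
  by case: (c x) (c y) => [][].
have [k wk min_k] := ex_minnP (lwalk_exists x y); exists k.
have min j : j < k -> ~~ lwalk a s j (edge x) (edge y).
  by rewrite ltnNge; apply: contra => /min_k.
by split=> //; rewrite (lwalk_parity cx cy Exy nxy wk min) E addbb.
Qed.

(** Adjacent triples correspond to ordered pairs of distinct chords of the middle face, oriented as
    darts of that face. *)
Lemma regular_aligned : regular_CERS a s o <-> aligned a s o c.
Proof.
split=> [reg x y cx cy Exy|al].
  have [-> //|nxy] := eqVneq x y.
  have nF : face (a x) != face (a y).
    by apply: contraNneq nxy => E; rewrite (chord_faces_inj C cx cy Exy E).
  have nx := no_bridge G x; have ny := no_bridge G y; rewrite -Exy in ny.
  have I z : chord z -> (face z \in inner_faces a s o) * (face (a z) \in inner_faces a s o).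
    by case/andP=> nz naz; rewrite !inner_face.
  (* Two distinct chords of a face already involve three inner faces. *)
  case: reg => [le2|reg].
    have : uniq [:: face x; face (a x); face (a y)].
      by rewrite /= !inE negb_or nF !(eq_sym (face x)) nx ny.
    move/card_uniqP => /= card3; suff : 3 <= 2 by [].
    rewrite -card3; apply: leq_trans le2; apply/subset_leq_card/subsetP => F.
    by rewrite !in_cons in_nil orbF => /or3P[]/eqP->; rewrite ?(I x cx) ?(I y cy).
  apply/(ldist_even_colour cx cy Exy nxy).
  apply: (reg (face (a x)) (face x) (face (a y))); rewrite ?(I x cx) ?(I y cy) ?mem_porbits //.
  - by rewrite eq_sym.
  - by apply/exists_inP; exists (a x); rewrite ?mem_edge ?eqxx ?orbT ?porbit_id.
  - by apply/exists_inP; exists x; rewrite ?porbit_id.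
  - by apply/exists_inP; exists y; rewrite ?porbit_id // Exy porbit_id.
  - by apply/exists_inP; exists (a y); rewrite ?mem_edge ?eqxx ?orbT ?porbit_id.
have between F F' e : F \in inner_faces a s o -> F' \in inner_faces a s o -> F != F' ->
    e \in edges a -> on_face e F -> on_face e F' ->
    exists x, [/\ chord x, e = edge x, F' = face x & F = face (a x)].
  move=> FI F'I nF /imsetP[z _ ->] /exists_inP[w wz wF] /exists_inP[x xz xF].
  have EF : F = face w.
    by case/setD1P: FI wF => _ /imsetP[u _ ->] /porbit_eq_of_mem.
  have EF' : F' = face x.
    by case/setD1P: F'I xF => _ /imsetP[u _ ->] /porbit_eq_of_mem.
  have Ew : w = a x.
    move: wz xz nF; rewrite EF EF' !mem_edge.
    by move=> /orP[]/eqP-> /orP[]/eqP->; rewrite ?(aK G) ?eqxx.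
  exists x; rewrite -Ew; split=> //; last by rewrite (porbit_eq_of_mem xz).
  by rewrite /is_chord -!inner_face -Ew -EF -EF' FI F'I.
right=> F F' F'' e f FI F'I F''I nFF' nF'F'' nFF'' eE fE eF eF' fF' fF''.
have [x [cx -> Ex Eax]] := between F F' e FI F'I nFF' eE eF eF'.
rewrite eq_sym in nF'F''.
have [y [cy -> Ey Eay]] := between F'' F' f F''I F'I nF'F'' fE fF'' fF'.
have Exy : face x = face y by rewrite -Ex.
have nxy : x != y by apply: contraNneq nFF'' => E; rewrite Eax Eay E.
by apply/(ldist_even_colour cx cy Exy nxy)/al.
Qed.

End LineDistance.

Theorem theorem4p2 (D : finType) (a s : {perm D}) (o : D) :
  CERS a s o ->
  (regular_CERS a s o <->
   is_daisy_cube (perfect_matchings a s) (res_adj a s o)).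
Proof.
move=> C; have [c [cs ca]] := bipartition (proj1 C).
split=> [/(regular_aligned C cs ca) | H]; first exact: aligned_daisy.
by apply/(regular_aligned C cs ca)/daisy_aligned.
Qed.
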